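(* The left-truncated lognormal distribution is not always infinitely divisible. In particular, the left-truncated $(\alpha,\sigma)$-lognormal distribution with truncation interval $(0,b)$ is not infinitely divisible when $\alpha=0$, $\sigma=1$ and $\log b=-1.4$.
   Context: The $(\alpha,\sigma)$-lognormal distribution is the probability measure on $\mathbf{R}_+$ with density $\frac{1}{\sqrt{2\pi\sigma^2}\,y}\exp\{-\frac{(\log y-\alpha)^2}{2\sigma^2}\}$, $y>0$. The left-truncated lognormal is constructed by removing the mass over the interval $(0,b)$, $b>0$, and transferring the removed mass to the origin (as an atom at $0$). A probability measure is infinitely divisible if for every integer $n\ge1$ it is the $n$-fold convolution of some probability measure. *)

(* Defs.v *)
From HB Require Import structures.
From mathcomp Require Import all_boot all_order all_algebra.
From mathcomp Require Import all_classical all_reals all_analysis.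
From mathcomp Require Import measurable_realfun interval_inference ring.

Set Implicit Arguments.
Unset Strict Implicit.
Unset Printing Implicit Defensive.

Import Order.TTheory GRing.Theory Num.Theory.
Import numFieldNormedType.Exports.

Local Open Scope classical_set_scope.
Local Open Scope ring_scope.

Definition lognormal_pdf {R : realType} (alpha : R) (sigma : {posnum R})
    (y : R) : R :=
  if 0 < y then
    (Num.sqrt (2 * pi * sigma%:num ^+ 2) * y)^-1 *
    expR (- ((ln y - alpha) ^+ 2 / (2 * sigma%:num ^+ 2)))
  else 0.

Definition lognormal_prob {R : realType} (alpha : R) (sigma : {posnum R}) :
    set R -> \bar R :=
  fun V => (\int[lebesgue_measure]_(y in V) (lognormal_pdf alpha sigma y)%:E)%E.

Section lognormal_probability.
Context {R : realType} (alpha : R) (sigma : {posnum R}).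
Local Notation pdf := (lognormal_pdf alpha sigma).
Local Notation lognormal := (lognormal_prob alpha sigma).

Lemma lognormal_pdf_ge0 y : 0 <= pdf y.
Proof.
rewrite /lognormal_pdf; case: ifPn => // y0.
by rewrite mulr_ge0 ?expR_ge0// invr_ge0 mulr_ge0 ?sqrtr_ge0// ltW.
Qed.

Lemma lognormal_pdfE y : 0 < y ->
  pdf y = normal_pdf alpha sigma%:num (ln y) * y^-1.
Proof.
move=> y0; rewrite /lognormal_pdf y0 normal_pdfE ?gt_eqF//.
rewrite /normal_peak /normal_fun.
rewrite (_ : sigma%:num ^+ 2 * pi *+ 2 = 2 * pi * sigma%:num ^+ 2); last by ring.
rewrite (_ : sigma%:num ^+ 2 *+ 2 = 2 * sigma%:num ^+ 2); last by ring.
by rewrite invfM mulNr mulrAC.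
Qed.

Lemma measurable_lognormal_pdf : measurable_fun [set: R] pdf.
Proof.
rewrite (_ : pdf = fun y => if 0 < y then
    normal_pdf alpha sigma%:num (ln y) * expR (- ln y) else 0); last first.
  apply/funext => y; case: ifPn => y0; last by rewrite /lognormal_pdf (negbTE y0).
  by rewrite lognormal_pdfE// expRN lnK.
apply: measurable_fun_ifT => //=.
  exact: measurable_fun_ltr.
apply: measurable_funM.
  by apply: measurableT_comp => //; exact: measurable_normal_pdf.
apply: measurableT_comp => //; exact: measurableT_comp.
Qed.

Let lognormal0 : lognormal set0 = 0%E.
Proof. by rewrite /lognormal_prob integral_set0. Qed.

Let lognormal_ge0 A : (0 <= lognormal A)%E.
Proof.
by apply: integral_ge0 => y _; rewrite lee_fin lognormal_pdf_ge0.
Qed.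

Let lognormal_sigma_additive : semi_sigma_additive lognormal.
Proof.
move=> /= F mF tF mUF; rewrite /lognormal_prob; apply: cvg_toP.
  apply: ereal_nondecreasing_is_cvgn => m n mn.
  by apply: lee_sum_nneg_natr => // k _ _; exact: lognormal_ge0.
rewrite ge0_integral_bigcup//=.
- apply/measurable_funTS/measurableT_comp => //.
  exact: measurable_lognormal_pdf.
- by move=> y _; rewrite lee_fin lognormal_pdf_ge0.
Qed.

HB.instance Definition _ := isMeasure.Build _ _ _
  lognormal lognormal0 lognormal_ge0 lognormal_sigma_additive.

Lemma cvgr_lny : @ln R x @[x --> +oo] --> +oo.
Proof.
apply/cvgryPge => A; near=> x.
rewrite -[leLHS]expRK ler_ln ?posrE ?expR_gt0//.
Unshelve. all: end_near. Qed.

Lemma lognormal_probcy a : 0 < a ->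
  lognormal `[a, +oo[ = normal_prob alpha sigma%:num `[ln a, +oo[.
Proof.
move=> a0; rewrite /normal_prob.
have ln'E y : a <= y -> ((@ln R)^`())%classic y = y^-1.
  move=> ay; have y0 := lt_le_trans a0 ay.
  by rewrite derive1E; have /@derive_val := is_derive1_ln y0.
rewrite (increasing_ge0_integration_by_substitutiony (F := @ln R)).
- apply: eq_integral => y; rewrite inE/= in_itv/= andbT => ay.
  by rewrite lognormal_pdfE ?(lt_le_trans a0)//= fctE/= ln'E.
- move=> x y; rewrite !in_itv/= !andbT => ax ay xy.
  by rewrite ltr_ln// posrE (lt_le_trans a0).
- move=> y; rewrite in_itv/= andbT => ay; rewrite /continuous_at ln'E ?ltW//.
  have y0 := lt_trans a0 ay.
  apply: cvg_trans (inv_continuous (lt0r_neq0 y0)).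
  apply: near_eq_cvg; near=> z; rewrite ln'E//.
  by near: z; exact: lt_le_nbhsr.
- apply/cvg_ex; exists a^-1.
  apply: cvg_trans (cvg_at_right_filter (inv_continuous (lt0r_neq0 a0))).
  by apply: near_eq_cvg; near=> z; rewrite ln'E.
- apply/cvg_ex; exists 0.
  have V0 : x^-1 @[x --> +oo] --> (0 : R).
    by apply/(gtr0_cvgV0 (f := id)); [near=> x|exact: cvg_id].
  apply: cvg_trans V0.
  by apply: near_eq_cvg; near=> z; rewrite ln'E.
- split=> [y|]; last by apply: cvg_at_right_filter; exact: continuous_ln.
  rewrite in_itv/= andbT => ay.
  by have /@ex_derive := is_derive1_ln (lt_trans a0 ay).
- exact: cvgr_lny.
- by apply: continuous_subspaceT; exact: continuous_normal_pdf.
- by move=> x _; exact: normal_pdf_ge0.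
Unshelve. all: end_near. Qed.

Let F (n : nat) : set R := [set` `[expR (- n%:R), +oo[].

Let bigcup_F : \bigcup_n F n = [set` `]0 : R, +oo[].
Proof.
apply/seteqP; split => [y [n _]|y]; rewrite /F/= !in_itv/= !andbT.
  by apply: lt_le_trans; exact: expR_gt0.
move=> y0; exists (Num.truncn `|ln y|).+1 => //.
rewrite /F/= in_itv/= andbT -[leRHS]lnK ?posrE// ler_expR lerNl.
by rewrite (le_trans (ler_norm _))// normrN ltW// truncnS_gt.
Qed.

Let lognormal_setT : lognormal [set: R] = 1%E.
Proof.
have -> : lognormal [set: R] = lognormal [set` `]0 : R, +oo[].
  rewrite /lognormal_prob [RHS]integral_mkcond; apply: eq_integral => y _.
  rewrite patchE; case: ifPn => //; rewrite notin_setE/= in_itv/= andbT.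
  by move=> /negP y0; rewrite /lognormal_pdf (negbTE y0).
pose G (n : nat) : set R := [set` `[- n%:R, +oo[].
have GT : \bigcup_n G n = [set: R].
  apply/seteqP; split => // y _; exists (Num.truncn `|y|).+1 => //.
  rewrite /G/= in_itv/= andbT lerNl.
  by rewrite (le_trans (ler_norm _))// normrN ltW// truncnS_gt.
have mF (n : nat) : measurable (F n) by exact: measurable_itv.
have mG (n : nat) : measurable (G n) by exact: measurable_itv.
rewrite -bigcup_F.
have cF : (lognormal \o F) n @[n --> \oo] --> lognormal (\bigcup_n F n).
  apply: nondecreasing_cvg_mu => //; first by rewrite bigcup_F.
  move=> m n mn; apply/subsetPset => y; rewrite /F/= !in_itv/= !andbT.
  by apply: le_trans; rewrite ler_expR lerN2 ler_nat.
have cG : (normal_prob alpha sigma%:num \o G) n @[n --> \oo] -->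
    normal_prob alpha sigma%:num (\bigcup_n G n).
  apply: nondecreasing_cvg_mu => //; first by rewrite GT.
  move=> m n mn; apply/subsetPset => y; rewrite /G/= !in_itv/= !andbT.
  by apply: le_trans; rewrite lerN2 ler_nat.
transitivity (normal_prob alpha sigma%:num (\bigcup_n G n)); last first.
  by rewrite GT probability_setT.
rewrite -(cvg_lim _ cF)// -(cvg_lim _ cG)//; congr (limn _).
by apply/funext => n /=; rewrite lognormal_probcy ?expR_gt0// expRK.
Qed.

HB.instance Definition _ :=
  @Measure_isProbability.Build _ _ R lognormal lognormal_setT.

End lognormal_probability.

Definition left_truncation {R : realType} (b : R) (P : set R -> \bar R) :
    set R -> \bar R :=
  fun V => (P (V `\` `]0%R, b[%classic) + P `]0%R, b[%classic * \d_(0%R : R) V)%E.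

Section left_truncation_probability.
Context {R : realType} (b : R) (P : probability R R).
Local Notation trunc := (left_truncation b P).

Let trunc0 : trunc set0 = 0%E.
Proof. by rewrite /left_truncation set0D !measure0 mule0 adde0. Qed.

Let trunc_ge0 V : (0 <= trunc V)%E.
Proof. by rewrite adde_ge0// mule_ge0. Qed.

Let trunc_sigma_additive : semi_sigma_additive trunc.
Proof.
pose C := ~` [set` `]0 : R, b[].
have mC : measurable C by exact: measurableC.
have r0 : (0 <= fine (P `]0%R, b[%classic))%R by exact: fine_ge0.
pose m := measure_add (mrestr P mC) (mscale (NngNum r0) (\d_(0 : R))).
rewrite (_ : trunc = m); first exact: measure_semi_sigma_additive.
apply/funext => V; rewrite /m measure_addE /left_truncation.
rewrite setDE; congr (_ + _ * _)%E; apply/esym; rewrite /=.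
exact: (fineK (fin_num_measure P _ _)).
Qed.

HB.instance Definition _ := isMeasure.Build _ _ _
  trunc trunc0 trunc_ge0 trunc_sigma_additive.

Let trunc_setT : trunc [set: R] = 1%E.
Proof.
rewrite /left_truncation diracT mule1 -measureU//.
- rewrite setDKU//; exact: probability_setT.
- exact: measurableD.
- by rewrite setDE -setIA setICl setI0.
Qed.

HB.instance Definition _ :=
  @Measure_isProbability.Build _ _ R trunc trunc_setT.

End left_truncation_probability.

Definition add_pair {R : realType} (z : R * R) : R := z.1 + z.2.

Section add_pair_measurable.
Context {R : realType}.

Let measurable_add_pair : measurable_fun [set: R * R] (@add_pair R).
Proof. exact: measurable_funD. Qed.

HB.instance Definition _ :=
  isMeasurableFun.Build _ _ _ _ (@add_pair R) measurable_add_pair.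

End add_pair_measurable.

Definition convolution {R : realType} (P Q : probability R R) :
  probability R R := distribution (P \x Q)%E (@add_pair R).

Fixpoint convolution_pow {R : realType} (P : probability R R) (n : nat) :
    probability R R :=
  if n is m.+1 then convolution P (convolution_pow P m) else \d_(0 : R).

(* Equality of measures is only required on measurable sets: the library's
   set functions have junk values elsewhere. *)
Definition infinitely_divisible {R : realType} (P : probability R R) : Prop :=
  forall n : nat, (1 <= n)%N -> exists Q : probability R R,
    forall V : set R, measurable V -> P V = convolution_pow Q n V.

(* Main.v *)
(** If Q is an n-th convolution root of the truncated law P, then Q puts no mass
    outside {0} and [b, +oo[, so on [b, 2b[ only one of the n summands is
    nonzero: P = n q^(n-1) Q there, with q = Q{0} and q^n = P{0}. Keeping only
    the terms with exactly two nonzero summands, both in [b, 2b[, and letting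
    n tend to infinity shows that the density f of an infinitely divisible P
    satisfies, just below 3b, P{0} f >= (f 1_[b, 2b[ * f 1_[b, 2b[) / 2. For
    log b = -1.4 one has f >= f(b) on [b, 2b[, f decreases near 3b, and the
    Mills ratio bounds P{0}; the resulting inequality
    b f(b)^2 <= 2 P{0} f(3b) is numerically false. *)
From HB Require Import structures.
Require Import Defs.
From mathcomp Require Import all_boot all_order all_algebra.
From mathcomp Require Import all_classical all_reals all_analysis.
From mathcomp Require Import measurable_realfun interval_inference ring lra.

Set Implicit Arguments.
Unset Strict Implicit.
Unset Printing Implicit Defensive.

Import Order.TTheory GRing.Theory Num.Theory.
Import numFieldNormedType.Exports.

Local Open Scope classical_set_scope.
Local Open Scope ring_scope.

(** * Real-valued masses of measurable sets *)

Section mass.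
Context d (T : measurableType d) (R : realType) (P : probability T R).

Definition mass A : R := fine (P A).

Lemma massK A : measurable A -> (mass A)%:E = P A.
Proof. by move=> mA; rewrite /mass fineK// fin_num_measure. Qed.

Lemma mass_ge0 A : 0 <= mass A.
Proof. exact: fine_ge0. Qed.

Lemma mass_le A B : measurable A -> measurable B -> A `<=` B ->
  mass A <= mass B.
Proof. by move=> mA mB AB; rewrite -lee_fin !massK// le_measure// inE. Qed.

Lemma massU_le A B : measurable A -> measurable B ->
  mass (A `|` B) <= mass A + mass B.
Proof.
move=> mA mB; rewrite -lee_fin EFinD !massK//; first exact: measureU2.
exact: measurableU.
Qed.

Lemma massU A B : measurable A -> measurable B -> A `&` B = set0 ->
  mass (A `|` B) = mass A + mass B.
Proof.
move=> mA mB AB; apply: EFin_inj; rewrite EFinD !massK ?measureU//.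
exact: measurableU.
Qed.

End mass.

(** * Lower bounds for product and convolution masses *)

Section convolution_mass.
Context {R : realType}.
Implicit Types (P Q : probability R R) (A B S : set R).

Lemma mass_setX P Q A B : measurable A -> measurable B ->
  mass (P \x Q)%E (A `*` B) = mass P A * mass Q B.
Proof.
move=> mA mB; apply: EFin_inj; rewrite EFinM !massK//.
  exact: product_measure1E.
exact: measurableX.
Qed.

Lemma measurable_add_pair_preimage S : measurable S ->
  measurable (@Defs.add_pair R @^-1` S).
Proof.
by move=> mS; rewrite -[X in measurable X]setTI; exact: measurable_funPT.
Qed.

Lemma convolution_massE P Q S :
  mass (convolution P Q) S = mass (P \x Q)%E (@Defs.add_pair R @^-1` S).
Proof. by []. Qed.

(** Fubini, with the integral of the section masses restricted to [A] and its integrand replaced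
    there by the constant [t]. *)
Lemma mass_prod_ge_section P Q A (E : set (R * R)) t : measurable A ->
  measurable E -> 0 <= t -> (forall u, A u -> t <= mass Q (xsection E u)) ->
  t * mass P A <= mass (P \x Q)%E E.
Proof.
move=> mA mE t0 tE; rewrite -lee_fin EFinM !massK//=.
apply: (@le_trans _ _ (\int[P]_(u in A) Q (xsection E u))%E).
  rewrite -integral_cst//; apply: ge0_le_integral => //=.
  - by apply/measurable_funTS; exact: measurable_fun_xsection.
  - by move=> u Au; rewrite -massK ?lee_fin ?tE//; exact: measurable_xsection.
by apply: ge0_subset_integral => //=; exact: measurable_fun_xsection.
Qed.

Lemma convolution_mass_ge P Q A B S : measurable A -> measurable B ->
  measurable S -> (forall u v, A u -> B v -> S (u + v)) ->
  mass P A * mass Q B <= mass (convolution P Q) S.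
Proof.
move=> mA mB mS ABS; rewrite convolution_massE -mass_setX//.
apply: mass_le; [exact: measurableX|exact: measurable_add_pair_preimage|].
by move=> [u v] [/= Au Bv]; exact: ABS.
Qed.

End convolution_mass.

(** * Upper bounds off a null set, and convolution of laws carried by 0 and [b, +oo[ *)

Section convolution_upper.
Context {R : realType}.
Implicit Types (P Q : probability R R) (A S Z : set R) (b : R).

(** A cylinder over a null set is null for the product, so [E] has to cover the preimage of [S] only
    where both coordinates avoid [Z]. *)
Lemma convolution_mass_le P Q Z S (E : set (R * R)) : measurable Z ->
  measurable S -> measurable E -> mass P Z = 0 -> mass Q Z = 0 ->
  (forall u v, ~ Z u -> ~ Z v -> S (u + v) -> E (u, v)) ->
  mass (convolution P Q) S <= mass (P \x Q)%E E.
Proof.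
move=> mZ mS mE PZ QZ SE; rewrite convolution_massE.
have mZT : measurable (Z `*` [set: R]) by exact: measurableX.
have mTZ : measurable ([set: R] `*` Z) by exact: measurableX.
have mZZ := measurableU _ _ mZT mTZ.
apply: (@le_trans _ _ (mass (P \x Q)%E (E `|` (Z `*` setT `|` setT `*` Z)))).
  apply: mass_le; [exact: measurable_add_pair_preimage|exact: measurableU|].
  move=> [u v] /= Suv; have [Zu|Zu] := pselect (Z u); first by right; left.
  by have [Zv|Zv] := pselect (Z v); [right; right|left; exact: SE].
rewrite (le_trans (massU_le _ _ _))// gerDl.
by rewrite (le_trans (massU_le _ _ _))// !mass_setX// PZ QZ mul0r mulr0 addr0.
Qed.

(** Two nonnegative numbers have a nonnegative sum, which vanishes only if both do. *)
Lemma convolution_mass0 P Q : mass P `]-oo, 0[%classic = 0 ->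
  mass Q `]-oo, 0[%classic = 0 ->
  mass (convolution P Q) `]-oo, 0[%classic = 0 /\
  mass (convolution P Q) [set 0] <= mass P [set 0] * mass Q [set 0].
Proof.
move=> PN QN; split.
  apply/eqP; rewrite eq_le mass_ge0 andbT.
  have PQ0 : mass (P \x Q)%E set0 = 0 by rewrite /mass measure0.
  rewrite -[leRHS]PQ0.
  apply: (convolution_mass_le _ _ _ PN QN) => // u v /=.
  rewrite !in_itv/= => /negP; rewrite -leNgt => ? /negP.
  by rewrite -leNgt => ? ?; lra.
rewrite -mass_setX//; apply: (convolution_mass_le _ _ _ PN QN) => //.
  exact: measurableX.
move=> u v /=; rewrite !in_itv/= => /negP; rewrite -leNgt => ? /negP.
by rewrite -leNgt => ? uv; split; lra.
Qed.

(** The negative numbers are included along with ]0, b[, so a null gap says in one equation that the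
    law is carried by 0 and [b, +oo[. *)
Definition gap b : set R := `]-oo, b[%classic `\ 0.

Lemma measurable_gap b : measurable (gap b).
Proof. exact: measurableD. Qed.

Lemma notin_gap b u : ~ gap b u -> u = 0 \/ b <= u.
Proof.
move=> /not_andP[|/contrapT]; last by left.
by rewrite /= in_itv/= => /negP; rewrite -leNgt; right.
Qed.

Lemma notin_gap_ge0 b u : 0 < b -> ~ gap b u -> 0 <= u.
Proof. by move=> b0 /notin_gap[->|bu]//; exact: le_trans (ltW b0) bu. Qed.

(** The union of {0} and [b, +oo[ is closed under addition when b > 0. *)
Lemma convolution_gap P Q b : 0 < b -> mass P (gap b) = 0 ->
  mass Q (gap b) = 0 -> mass (convolution P Q) (gap b) = 0.
Proof.
move=> b0 Pb Qb; apply/eqP; rewrite eq_le mass_ge0 andbT.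
have PQ0 : mass (P \x Q)%E set0 = 0 by rewrite /mass measure0.
rewrite -[leRHS]PQ0.
have mb := measurable_gap b.
apply: (convolution_mass_le _ _ _ Pb Qb) => // u v /notin_gap ub /notin_gap vb.
rewrite /gap/= in_itv/= => -[uv uv0].
by case: ub vb => ub [] vb; [apply: uv0; rewrite ub vb addr0|lra..].
Qed.

(** Two summands that are both at least b add up to at least 2b, and two zero summands to 0 < b. A
    sum in [A] therefore has exactly one zero summand. *)
Lemma convolution_massD P Q b A : 0 < b -> mass P (gap b) = 0 ->
  mass Q (gap b) = 0 -> measurable A -> A `<=` `[b, b + b[%classic ->
  mass (convolution P Q) A =
  mass P A * mass Q [set 0] + mass P [set 0] * mass Q A.
Proof.
move=> b0 Pb Qb mA Ab; have mb := measurable_gap b.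
have m1 : measurable (A `*` [set (0 : R)]) by exact: measurableX.
have m2 : measurable ([set (0 : R)] `*` A) by exact: measurableX.
rewrite -!mass_setX// -massU//; last first.
  apply/seteqP; split => // -[u v] [[/= Au ->] [_ A0]].
  by have := Ab _ A0; rewrite /= in_itv/=; lra.
apply/eqP; rewrite eq_le; apply/andP; split.
  apply: (convolution_mass_le _ _ _ Pb Qb) => //; first exact: measurableU.
  move=> u v /notin_gap ub /notin_gap vb Auv.
  have := Ab _ Auv; rewrite /= in_itv/= => /andP[uvb uvb2].
  case: vb => vb; first by left; split => //; rewrite vb addr0 in Auv.
  case: ub => ub; last by lra.
  by right; split => //; rewrite ub add0r in Auv.
rewrite convolution_massE; apply: mass_le.
- exact: measurableU.
- exact: measurable_add_pair_preimage.
- move=> [u v] [] /= [] => [Au ->|-> Av].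
    by rewrite /Defs.add_pair/= addr0.
  by rewrite /Defs.add_pair/= add0r.
Qed.

End convolution_upper.

(** * From a convolution power back to its root *)

Section convolution_root.
Context {R : realType} (Q : probability R R).
Local Notation Qn n := (convolution_pow Q n).

Lemma dirac_mass (a : R) (A : set R) :
  mass (\d_a : probability R R) A = (a \in A)%:R.
Proof.
have dE : (\d_a A = (a \in A)%:R%:E :> \bar R) by rewrite diracE.
exact: (congr1 fine dE).
Qed.

(** All summands in [A] force the sum into [A]. The exponent is a successor because the zeroth power
    is the point mass at 0, which need not lie in [A]. *)
Lemma convolution_pow_mass_ge (A : set R) n : measurable A ->
  (forall u v, A u -> A v -> A (u + v)) ->
  mass Q A ^+ n.+1 <= mass (Qn n.+1) A.
Proof.
move=> mA AD; elim: n => [|n IHn].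
  rewrite expr1 -[leLHS]mulr1.
  rewrite -(_ : mass (Qn 0) [set 0] = 1); last by rewrite dirac_mass mem_set.
  by apply: convolution_mass_ge => // u v Au ->; rewrite addr0.
rewrite exprS (le_trans _ (convolution_mass_ge _ _ mA mA mA AD))//.
by rewrite ler_wpM2l// mass_ge0.
Qed.

(** This carries the support of an infinitely divisible law over to its roots. Negative mass is
    excluded first, since the bound on the atom relies on nonnegative summands. *)
Lemma convolution_pow_gap n b : 0 < b -> mass (Qn n.+1) (gap b) = 0 ->
  0 < mass (Qn n.+1) [set 0] -> mass Q (gap b) = 0 /\ 0 < mass Q [set 0].
Proof.
move=> b0 Qb Q0; have mb := measurable_gap b.
(* The negative half-line is closed under addition and contained in the gap, so a power of its
   [Q]-mass is at most 0. *)
have QN : mass Q `]-oo, 0[%classic = 0.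
  have N n' : mass Q `]-oo, 0[%classic ^+ n'.+1 <=
      mass (Qn n'.+1) `]-oo, 0[%classic.
    by apply: convolution_pow_mass_ge => // u v; rewrite /= !in_itv/=; lra.
  suff: mass Q `]-oo, 0[%classic ^+ n.+1 == 0.
    by rewrite expf_eq0/= => /eqP.
  rewrite eq_le exprn_ge0 ?mass_ge0// andbT.
  rewrite (le_trans (N n))// -[leRHS]Qb; apply: mass_le => // u.
  rewrite /gap/= !in_itv/= => u0; split; first exact: lt_trans b0.
  by move=> u0'; rewrite u0' ltxx in u0.
(* Without negative mass a zero sum needs every summand zero, so a positive atom of the power forces
   a positive atom of [Q]. *)
have QnN k : mass (Qn k) `]-oo, 0[%classic = 0 /\
    mass (Qn k) [set 0] <= mass Q [set 0] ^+ k.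
  elim: k => [|k [IH0 IH]].
    by rewrite !dirac_mass memNset ?mem_set//= in_itv/= ltxx.
  have [-> le0] := convolution_mass0 QN IH0; split => //.
  by rewrite exprS (le_trans le0)// ler_wpM2l// mass_ge0.
have q0 : 0 < mass Q [set 0].
  rewrite lt_neqAle mass_ge0 andbT eq_sym; apply: contraL (Q0) => /eqP q0.
  by have [_] := QnN n.+1; rewrite q0 expr0n/= -leNgt.
split => //; apply/eqP; rewrite eq_le mass_ge0 andbT.
case: n => [|n] in Qb Q0 *.
  rewrite -Qb -[leLHS]mulr1.
  rewrite -(_ : mass (Qn 0) [set 0] = 1); last by rewrite dirac_mass mem_set.
  by apply: convolution_mass_ge => // u v Au ->; rewrite addr0.
(* One summand in the gap and the other [n.+1] at 0 give a sum in the gap: Q(gap) q^(n+1) <= 0. *)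
rewrite -(pmulr_lle0 _ (exprn_gt0 n.+1 q0)) -[leRHS]Qb.
apply: (@le_trans _ _ (mass Q (gap b) * mass (Qn n.+1) [set 0])).
  rewrite ler_wpM2l ?mass_ge0//; apply: convolution_pow_mass_ge => // u v -> ->.
  by rewrite /= addr0.
by apply: convolution_mass_ge => // u v Au ->; rewrite addr0.
Qed.

Section gap.
Context (b : R) (b0 : 0 < b) (Qb : mass Q (gap b) = 0).
Local Notation q := (mass Q [set 0]).

Lemma convolution_pow_gap0 n : mass (Qn n) (gap b) = 0.
Proof.
elim: n => [|n IHn]; last exact: convolution_gap.
by rewrite dirac_mass memNset// => -[_]; apply.
Qed.

Lemma convolution_pow_mass0 n : mass (Qn n) [set 0] = q ^+ n.
Proof.
elim: n => [|n IHn]; first by rewrite dirac_mass mem_set.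
rewrite exprS -IHn; apply/eqP; rewrite eq_le; apply/andP; split.
  have mb := measurable_gap b; rewrite -mass_setX//.
  apply: (convolution_mass_le mb _ _ Qb (convolution_pow_gap0 n)) => //.
    exact: measurableX.
  move=> u v /(notin_gap_ge0 b0) u0 /(notin_gap_ge0 b0) v0 /eqP.
  by rewrite paddr_eq0// => /andP[/eqP-> /eqP->].
by apply: convolution_mass_ge => // u v -> ->; exact: addr0.
Qed.

(** Exactly one of the n summands is nonzero, which gives n q^(n-1) Q(A). The extra factor q on both
    sides avoids the exponent n-1. *)
Lemma convolution_pow_massE n (A : set R) : measurable A ->
  A `<=` `[b, b + b[%classic -> q * mass (Qn n) A = n%:R * q ^+ n * mass Q A.
Proof.
move=> mA Ab; elim: n => [|n IHn].
  rewrite dirac_mass memNset ?mul0r ?mulr0// => /Ab.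
  by rewrite /= in_itv/=; lra.
rewrite (convolution_massD b0 Qb (convolution_pow_gap0 n) mA Ab) mulrDr IHn.
by rewrite convolution_pow_mass0 exprS -addn1 natrD; ring.
Qed.

End gap.
End convolution_root.

(** * Sums with exactly two nonzero summands, just below 3b *)

Section strip.
Context {R : realType} (Q : probability R R) (b e s t : R).
Context (b0 : 0 < b) (Qb : mass Q (gap b) = 0) (t0 : 0 <= t).
Context (Qt : forall x, b <= x -> x + e <= b + b ->
  t <= mass Q `[x, x + e[%classic).
Context (Qs : s <= mass Q `[b, b + b - e[%classic).
Local Notation q := (mass Q [set 0]).
Context (q0 : 0 < q).
Local Notation C := `[3 * b - e, 3 * b[%classic.

(** The first summand u stays below 2b - e so that the remainder, in [3b-e-u, 3b-u[, falls inside
    [b, 2b[, where only one of the other summands is nonzero. *)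
Let strip : set (R * R) :=
  (`[b, b + b - e[%classic `*` setT) `&` (@Defs.add_pair R @^-1` C).

Let measurable_strip : measurable strip.
Proof.
apply: measurableI; first exact: measurableX.
exact: measurable_add_pair_preimage.
Qed.

Let xsection_strip u : b <= u -> u < b + b - e ->
  xsection strip u = `[3 * b - e - u, 3 * b - e - u + e[%classic.
Proof.
move=> bu ub; apply/seteqP; split => v; rewrite /xsection/= in_setE /strip/=.
  by rewrite /Defs.add_pair/= !in_itv/= => -[_]; lra.
rewrite /Defs.add_pair/= !in_itv/= => v12; split; last by lra.
by split => //; lra.
Qed.

(** Each section has length e inside [b, 2b[, hence mass at least k q^(k-1) t; integrating over u
    contributes the factor s. *)
Let strip_ge k : k%:R * q ^+ k * (t * s) <=
  q * mass (Q \x convolution_pow Q k)%E strip.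
Proof.
pose r := k%:R * q ^+ k * t.
have r0 : 0 <= r by rewrite !mulr_ge0// exprn_ge0// ltW.
have -> : k%:R * q ^+ k * (t * s) = r * s by rewrite mulrA.
rewrite [leRHS]mulrC -ler_pdivrMr// mulrAC.
rewrite (le_trans (ler_wpM2l (divr_ge0 r0 (ltW q0)) Qs))//.
apply: mass_prod_ge_section => //; first by rewrite divr_ge0// ltW.
move=> u /=; rewrite in_itv/= => /andP[bu ub].
rewrite xsection_strip// ler_pdivrMr// [leRHS]mulrC.
rewrite (convolution_pow_massE b0 Qb)//; last first.
  by move=> v /=; rewrite !in_itv/=; lra.
rewrite /r ler_wpM2l//; first by rewrite mulr_ge0// exprn_ge0// ltW.
by apply: Qt; lra.
Qed.

(** Pascal's rule C(k+1, 2) = C(k, 2) + k: either the first summand is 0 and two of the other k are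
    nonzero, or it lies in [b, 2b-e[ and one of the others is nonzero. The factor q^2 on the right
    again avoids the exponent k-2. *)
Lemma convolution_pow_strip k :
  'C(k, 2)%:R * q ^+ k * (t * s) <= q ^+ 2 * mass (convolution_pow Q k) C.
Proof.
elim: k => [|k IHk].
  by rewrite bin0n !mul0r mulr_ge0 ?mass_ge0// exprn_ge0// ltW.
have m0C : measurable ([set (0 : R)] `*` C) by exact: measurableX.
have : q * mass (convolution_pow Q k) C +
    mass (Q \x convolution_pow Q k)%E strip <= mass (convolution_pow Q k.+1) C.
  rewrite -mass_setX// -massU//; last first.
    apply/seteqP; split => // -[u v] /= [[/= -> _] [[/=]]].
    by rewrite in_itv/= leNgt b0.
  rewrite [leRHS]convolution_massE; apply: mass_le.
  - exact: measurableU.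
  - exact: measurable_add_pair_preimage.
  - by move=> [u v] [[/= -> Cv]|[//]]; rewrite /Defs.add_pair/= add0r.
rewrite -(ler_pM2l (exprn_gt0 2 q0)); apply: le_trans.
have -> : 'C(k.+1, 2)%:R * q ^+ k.+1 * (t * s) =
    q * ('C(k, 2)%:R * q ^+ k * (t * s)) + q * (k%:R * q ^+ k * (t * s)).
  by rewrite binS bin1 natrD exprS; ring.
rewrite mulrDr lerD//; first by rewrite [leRHS]mulrCA ler_wpM2l// ltW.
by rewrite expr2 -[leRHS]mulrA ler_wpM2l// ltW.
Qed.

End strip.

(** An (n+1)-th root gives C(n+1, 2) X <= (n+1)^2 Y, that is n X <= 2 (n+1) Y, and n tends to
    infinity. Here [c] is a lower bound for the density of [P] on [b, 2b[. *)
Lemma infinitely_divisible_strip (R : realType) (P : probability R R)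
    (b c e : R) : 0 < b -> 0 <= c -> 0 < e -> e < b ->
  infinitely_divisible P -> mass P (gap b) = 0 -> 0 < mass P [set 0] ->
  (forall x y, b <= x -> x <= y -> y <= b + b ->
    c * (y - x) <= mass P `[x, y[%classic) ->
  c ^+ 2 * (e * (b - e)) / 2 <=
  mass P [set 0] * mass P `[3 * b - e, 3 * b[%classic.
Proof.
move=> b0 c0 e0 eb Pid Pb P0 Pc.
set X := c ^+ 2 * _; set Y := _ * mass P _.
have XY n : n%:R * X <= n.+1%:R * (2 * Y).
  have [//|Q PQ] := Pid n.+1.
  have PQn A : measurable A -> mass P A = mass (convolution_pow Q n.+1) A.
    by move=> mA; rewrite /mass PQ.
  have mb := measurable_gap b.
  have [Qb q0] : mass Q (gap b) = 0 /\ 0 < mass Q [set 0].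
    by apply: (@convolution_pow_gap _ _ n) => //; rewrite -PQn.
  have PE : mass P [set 0] = mass Q [set 0] ^+ n.+1.
    by rewrite PQn// (convolution_pow_mass0 b0 Qb).
  set q := mass Q [set 0] in q0 PE *.
  have qn0 : 0 < q ^+ n.+1 by exact: exprn_gt0.
  (* By [convolution_pow_massE], q P(A) = (n+1) q^(n+1) Q(A) for A within [b, 2b[, so the bound [c]
     for [P] becomes the bound [r] for [Q]. *)
  pose r := q * c / (n.+1%:R * q ^+ n.+1).
  have r0 : 0 <= r.
    by rewrite divr_ge0// mulr_ge0// ltW.
  have Qr x y : b <= x -> x <= y -> y <= b + b ->
      r * (y - x) <= mass Q `[x, y[%classic.
    move=> bx xy yb; rewrite /r mulrAC ler_pdivrMr ?mulr_gt0// [leRHS]mulrC.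
    rewrite -(convolution_pow_massE b0 Qb)//; last first.
      by move=> z /=; rewrite !in_itv/=; lra.
    by rewrite -PQn// -mulrA ler_wpM2l ?(ltW q0)// Pc.
  have re0 : 0 <= r * e by rewrite mulr_ge0// ltW.
  have Qe x : b <= x -> x + e <= b + b -> r * e <= mass Q `[x, x + e[%classic.
    move=> bx xe; rewrite [X in _ * X <= _](_ : e = x + e - x); last by ring.
    by apply: Qr => //; lra.
  have Qbe : r * (b - e) <= mass Q `[b, b + b - e[%classic.
    rewrite [X in _ * X <= _](_ : b - e = b + b - e - b); last by ring.
    by apply: Qr; lra.
  have := convolution_pow_strip b0 Qb re0 Qe Qbe q0 n.+1.
  rewrite -PQn// -/q => H.
  have {}H : 'C(n.+1, 2)%:R * X <= n.+1%:R ^+ 2 * Y.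
    (* This multiplier cancels the factor r^2 and restores P{0} = q^(n+1) on the right. *)
    have n0 : 0 < n.+1%:R ^+ 2 * q ^+ n.+1 / q ^+ 2.
      by rewrite divr_gt0 ?exprn_gt0// mulr_gt0// exprn_gt0.
    move: H; rewrite -(ler_pM2l n0).
    congr (_ <= _); rewrite /X /Y /r ?PE; field.
      by rewrite !gt_eqF.
    by rewrite gt_eqF.
  rewrite -(ler_pM2l (_ : 0 < n.+1%:R)) ?ltr0n//.
  have := mul_bin_diag n.+1 1; rewrite bin1/= => /(congr1 (fun m => m%:R : R)).
  rewrite !natrM => nE.
  rewrite [leLHS]mulrA nE -mulrA.
  rewrite [leRHS](_ : _ = 2 * (n.+1%:R ^+ 2 * Y)); last by ring.
  by rewrite ler_pM2l.
rewrite ler_pdivrMr// mulrC leNgt; apply/negP => YX.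
have X0 : 0 <= X.
  by rewrite mulr_ge0 ?sqr_ge0// mulr_ge0 ?ltW// subr_gt0.
(* At [n.+1] the bound [XY] reads (n+1)(X - 2Y) <= 2Y, which fails for this n. *)
pose n := Num.truncn (2 * Y / (X - 2 * Y)).
have : 2 * Y < n.+1%:R * (X - 2 * Y).
  by rewrite -ltr_pdivrMr ?subr_gt0// truncnS_gt.
have := XY n.+1; rewrite -(natr1 n.+1); lra.
Qed.

(** The inequality 1 + y <= exp y at y = x/(n+1), raised to the power n+1. It supplies rational
    lower bounds for exp in the final numerics. *)
Lemma expR_ge_pow (R : realType) (x : R) n : 0 <= 1 + x / n.+1%:R ->
  (1 + x / n.+1%:R) ^+ n.+1 <= expR x.
Proof.
move=> x0; rewrite -[x in leRHS](divfK (_ : n.+1%:R != 0))//.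
by rewrite expRM_natr lerXn2r ?nnegrE ?expR_ge0// expR_ge1Dx.
Qed.

Lemma lebesgue_measure_itvco (R : realType) (x y : R) : x <= y ->
  lebesgue_measure `[x, y[%classic = (y - x)%:E.
Proof.
rewrite lebesgue_measure_itv/= lte_fin le_eqVlt => /predU1P[->|->]//.
by rewrite ltxx subrr.
Qed.

(** * Lognormal masses from density bounds, and masses after truncation *)

Section density_bounds.
Context {R : realType} (alpha : R) (sigma : {posnum R}).
Local Notation pdf := (lognormal_pdf alpha sigma).
Local Notation L := (lognormal_prob alpha sigma).

Let mpdf A : measurable_fun A (EFin \o pdf).
Proof.
by apply/measurable_EFinP/measurable_funTS; exact: measurable_lognormal_pdf.
Qed.

Lemma lognormal_mass_ge (c x y : R) : 0 <= c -> x <= y ->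
  (forall z, x <= z -> z < y -> c <= pdf z) ->
  c * (y - x) <= mass L `[x, y[%classic.
Proof.
move=> c0 xy cpdf; rewrite -lee_fin massK//.
have -> : (c * (y - x))%:E = (\int[lebesgue_measure]_(z in `[x, y[) c%:E)%E.
  by rewrite EFinM -lebesgue_measure_itvco// -integral_cst.
apply: ge0_le_integral => //=.
- exact: mpdf.
- by move=> z; rewrite in_itv/= => /andP[xz zy]; rewrite lee_fin cpdf.
Qed.

Lemma lognormal_mass_le (c x y : R) : x <= y ->
  (forall z, x <= z -> z < y -> pdf z <= c) ->
  mass L `[x, y[%classic <= c * (y - x).
Proof.
move=> xy cpdf; rewrite -lee_fin massK//.
have -> : (c * (y - x))%:E = (\int[lebesgue_measure]_(z in `[x, y[) c%:E)%E.
  by rewrite EFinM -lebesgue_measure_itvco// -integral_cst.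
apply: ge0_le_integral => //=.
- by move=> z _; rewrite lee_fin lognormal_pdf_ge0.
- exact: mpdf.
- by move=> z; rewrite in_itv/= => /andP[xz zy]; rewrite lee_fin cpdf.
Qed.

Lemma lognormal_mass_npos (A : set R) : measurable A ->
  A `<=` [set y | y <= 0] -> mass L A = 0.
Proof.
move=> mA A0; rewrite /mass/= /lognormal_prob integral0_eq// => y /A0/= y0.
by rewrite /lognormal_pdf ltNge y0.
Qed.

Lemma left_truncation_mass (b : R) (A : set R) : measurable A ->
  mass (left_truncation b L) A =
  mass L (A `\` `]0%R, b[%classic) + mass L `]0, b[%classic * (0 \in A)%:R.
Proof.
move=> mA; apply: EFin_inj; rewrite EFinD EFinM !massK//=.
exact: measurableD.
Qed.

(** The truncation empties ]0, b[, the lognormal law has no mass on the nonpositive numbers, and the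
    new atom sits at 0, outside the gap. *)
Lemma left_truncation_mass_gap (b : R) : 0 < b ->
  mass (left_truncation b L) (gap b) = 0.
Proof.
move=> b0; have mb := measurable_gap b.
rewrite left_truncation_mass// memNset ?mulr0 ?addr0//; last by case=> _; apply.
apply: lognormal_mass_npos; first exact: measurableD.
move=> y; rewrite /gap/= !in_itv/= => -[[yb y0]].
by rewrite yb andbT => /negP; rewrite -leNgt.
Qed.

Lemma left_truncation_mass0 (b : R) :
  mass (left_truncation b L) [set 0] = mass L `]0, b[%classic.
Proof.
rewrite left_truncation_mass// mem_set// mulr1 lognormal_mass_npos ?add0r//.
  exact: measurableD.
by move=> y [/= ->].
Qed.

Lemma left_truncation_mass_itv (b x y : R) : 0 < b -> b <= x ->
  mass (left_truncation b L) `[x, y[%classic = mass L `[x, y[%classic.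
Proof.
move=> b0 bx; rewrite left_truncation_mass// memNset; last first.
  by rewrite /= in_itv/= leNgt (lt_le_trans b0 bx).
rewrite mulr0 addr0; congr mass; apply/seteqP; split => z; first by case.
rewrite /= !in_itv/= => /andP[xz zy]; split; first by rewrite xz.
by rewrite [z < b]ltNge (le_trans bx xz) andbF.
Qed.

End density_bounds.

(** * The standard case: a Gaussian tail bound and the numerical contradiction *)

Section standard_lognormal.
Context {R : realType}.
Local Notation pdf := (@lognormal_pdf R 0 1%:pos).
Local Notation L := (@lognormal_prob R 0 1%:pos).

Let K : R := (Num.sqrt (2 * pi))^-1.

Let K_gt0 : 0 < K.
Proof. by rewrite invr_gt0 sqrtr_gt0 mulr_gt0// pi_gt0. Qed.

Lemma std_lognormal_pdfE (y : R) : 0 < y ->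
  pdf y = K * expR (- (ln y ^+ 2 / 2)) / y.
Proof.
move=> y0; rewrite /lognormal_pdf y0 subr0 !expr1n !mulr1 /K.
by rewrite invfM mulrAC.
Qed.

Lemma std_lognormal_pdf_expE (y : R) : 0 < y ->
  pdf y = K * expR (- (ln y ^+ 2 / 2) - ln y).
Proof.
by move=> y0; rewrite std_lognormal_pdfE// expRD (expRN (ln y)) lnK// mulrA.
Qed.

(* A Mills ratio bound: for r(t) = t / (t^2 + 11/20) one has t r - r' >= 1 when
   t >= 7/5, so phi r bounds the Gaussian tail; here t = - x. *)
Let tail x : R := K * expR (- (x ^+ 2 / 2)) * (- x / (x ^+ 2 + 11%:R / 20%:R)).

(** The derivative of [tail]: phi times t r - r' at t = - x, over a common denominator. *)
Let dtail x : R := K * expR (- (x ^+ 2 / 2)) *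
  (((x ^+ 2) ^+ 2 + 31%:R / 20%:R * x ^+ 2 - 11%:R / 20%:R) /
   (x ^+ 2 + 11%:R / 20%:R) ^+ 2).

Let den_gt0 x : 0 < x ^+ 2 + 11%:R / 20%:R :> R.
Proof. by have := sqr_ge0 x; lra. Qed.

Let is_derive_tail (x : R) : is_derive x 1 tail (dtail x).
Proof.
have d0 : x ^+ 2 + 11%:R / 20%:R != 0 by rewrite gt_eqF// den_gt0.
have dexp : is_derive x 1 (fun z : R => expR (- (z ^+ 2 / 2)))
    (- x * expR (- (x ^+ 2 / 2))).
  rewrite (_ : (fun z => _) = expR \o ((- 2^-1) *: (@id R ^+ 2))); last first.
    by apply/funext => z; rewrite /= !fctE /GRing.scale/= mulNr mulrC.
  apply: is_derive_eq; rewrite /= !fctE /GRing.scale/=.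
  rewrite [X in expR X](_ : _ = - (x ^+ 2 / 2)); last by ring.
  by field.
have dden : is_derive x 1 (fun z : R => z ^+ 2 + 11%:R / 20%:R) (2 * x).
  rewrite (_ : (fun z => _) = (@id R ^+ 2) + cst (11%:R / 20%:R))//.
  apply: is_derive_eq; by rewrite /GRing.scale/=; ring.
have dinv := @is_deriveV _ (fun z : R => z ^+ 2 + 11%:R / 20%:R) _ _ _ d0 dden.
rewrite (_ : tail = (K *: (fun z : R => expR (- (z ^+ 2 / 2)))) *
  (- id * (fun z => (z ^+ 2 + 11%:R / 20%:R)^-1)))//.
apply: is_derive_eq; rewrite !fctE /GRing.scale/= /dtail.
move: (expR _) => E; field.
by have := sqr_ge0 x => ?; rewrite gt_eqF//; lra.
Qed.

Let continuous_dtail : continuous dtail.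
Proof.
move=> x; have den0 : x ^+ 2 + 11%:R / 20%:R != 0 by rewrite gt_eqF// den_gt0.
have x2 : {for x, continuous (fun z : R => z ^+ 2)} by exact: exprn_continuous.
have den : {for x, continuous (fun z : R => z ^+ 2 + 11%:R / 20%:R)}.
  by apply: cvgD => //; exact: cvg_cst.
apply: cvgM.
  apply: cvgM; first exact: cvg_cst.
  apply: (@continuous_comp _ _ _ (fun z : R => - (z ^+ 2 / 2)) expR).
    by apply: cvgN; apply: cvgM => //; exact: cvg_cst.
  exact: continuous_expR.
apply: cvgM.
  apply: cvgB; last exact: cvg_cst.
  apply: cvgD; first by apply: cvgM.
  by apply: cvgM => //; exact: cvg_cst.
apply: cvgV; first by rewrite expf_neq0.
exact: cvgM.
Qed.

(** Completing the square in ln y; the maximum is at the mode y = 1/e. The bound controls the mass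
    near 0. *)
Lemma std_lognormal_pdf_le (y : R) : 0 < y -> pdf y <= K * expR 2^-1.
Proof.
move=> y0; rewrite std_lognormal_pdf_expE// ler_wpM2l ?(ltW K_gt0)// ler_expR.
have := sqr_ge0 (ln y + 1); rewrite sqrrD; lra.
Qed.

Let pdf_le_dtail (y : R) : 0 < y -> ln y <= - (14%:R / 10%:R) ->
  pdf y <= dtail (ln y) / y.
Proof.
move=> y0 lny; rewrite std_lognormal_pdfE// ler_pM2r ?invr_gt0// -[leLHS]mulr1.
rewrite ler_wpM2l ?mulr_ge0 ?expR_ge0 ?(ltW K_gt0)//.
rewrite ler_pdivlMr ?exprn_gt0 ?den_gt0// mul1r.
(* With a = 11/20 and t = (ln y)^2 the claim reduces to (1 - a) t >= a + a^2, that is t >= 341/180,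
   and 1.96 exceeds this. *)
have : 196%:R / 100%:R <= ln y ^+ 2 by nra.
by move: (ln y ^+ 2) => t; nra.
Qed.

(** On [d, b] the density is at most the derivative of [tail] composed with ln. The fundamental
    theorem of calculus applies since d > 0, and the nonnegative term at d is dropped. *)
Let std_lognormal_mass_tail (d b : R) : 0 < d -> d < b ->
  ln b <= - (14%:R / 10%:R) -> mass L `[d, b[%classic <= tail (ln b).
Proof.
move=> d0 db lnb; have b0 := lt_trans d0 db.
have pos (y : R) : d <= y -> 0 < y by exact: lt_le_trans.
have lnle (y : R) : 0 < y -> y <= b -> ln y <= - (14%:R / 10%:R).
  by move=> y0 yb; rewrite (le_trans _ lnb)// ler_ln.
have dG (y : R) : 0 < y -> is_derive y 1 (tail \o @ln R) (dtail (ln y) / y).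
  by move=> y0; have := is_derive1_ln y0 => ?; exact: is_derive1_comp.
have cG (y : R) : 0 < y -> {for y, continuous (tail \o @ln R)}.
  move=> y0; apply/differentiable_continuous/derivable1_diffP.
  by have [] := dG _ y0.
have cg (y : R) : 0 < y -> {for y, continuous (fun z => dtail (ln z) / z)}.
  move=> y0; apply: cvgM; last by apply: cvgV; [rewrite gt_eqF|exact: cvg_id].
  apply: (@continuous_comp _ _ _ (@ln R) dtail); first exact: continuous_ln.
  exact: continuous_dtail.
have FTC : (\int[lebesgue_measure]_(y in `[d, b]) (dtail (ln y) / y)%:E =
    (tail (ln b))%:E - (tail (ln d))%:E)%E.
  apply: (continuous_FTC2 (F := tail \o @ln R)) => //.
  - apply: continuous_in_subspaceT => y; rewrite inE/= in_itv/= => /andP[dy _].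
    exact/cg/pos.
  - split => [y| |].
    + by rewrite in_itv/= => /andP[/ltW/pos/dG[]].
    + exact/cvg_at_right_filter/cG.
    + exact/cvg_at_left_filter/cG.
  - move=> y; rewrite in_itv/= => /andP[/ltW/pos y0 _].
    by rewrite derive1E; have /@derive_val := dG _ y0.
have tail0 : 0 <= tail (ln d).
  apply: mulr_ge0; first by rewrite mulr_ge0 ?expR_ge0 ?(ltW K_gt0).
  rewrite divr_ge0 ?(ltW (den_gt0 _))//.
  by have := lnle _ d0 (ltW db); lra.
rewrite -lee_fin massK//; apply: (@le_trans _ _ (L `[d, b]%classic)).
  rewrite le_measure ?inE// => y /=; rewrite !in_itv/= => /andP[-> /ltW->//].
apply: (@le_trans _ _ ((tail (ln b))%:E - (tail (ln d))%:E)%E); last first.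
  by rewrite -EFinB lee_fin gerBl.
rewrite -FTC /=; apply: ge0_le_integral => //=.
- by move=> y _; rewrite lee_fin lognormal_pdf_ge0.
- apply/measurable_EFinP/measurable_funTS; exact: measurable_lognormal_pdf.
- apply/measurable_EFinP; apply: subspace_continuous_measurable_fun => //.
  apply: continuous_in_subspaceT => y; rewrite inE/= in_itv/= => /andP[dy _].
  exact/cg/pos.
- move=> y; rewrite in_itv/= => /andP[dy yb].
  by rewrite lee_fin pdf_le_dtail ?pos// lnle// pos.
Qed.

Lemma std_lognormal_mass_le (b : R) : 0 < b -> ln b <= - (14%:R / 10%:R) ->
  mass L `]0, b[%classic <=
  K * expR (- (ln b ^+ 2 / 2)) * (- ln b / (ln b ^+ 2 + 11%:R / 20%:R)).
Proof.
move=> b0 lnb; apply/ler_addgt0Pr => _/posnumP[x].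
pose M := K * expR 2^-1.
have M0 : 0 < M by rewrite mulr_gt0// expR_gt0.
(* The bound b/2 keeps d below b, and x/M makes the mass of [0, d[ at most x. *)
pose d := Num.min (b / 2) (x%:num / M).
have d0 : 0 < d by rewrite lt_min !divr_gt0.
have db : d < b by rewrite gt_min ltr_pdivrMr// ltr_pMr// ltr1n.
have Md : M * d <= x%:num by rewrite mulrC -ler_pdivlMr// ge_min lexx orbT.
apply: (@le_trans _ _ (mass L (`[d, b[%classic `|` `[0, d[%classic))).
  apply: mass_le => //; first exact: measurableU.
  move=> y /=; rewrite !in_itv/= => /andP[y0 yb].
  by case: (leP d y) => dy; [left; rewrite yb|right; rewrite ltW].
rewrite (le_trans (massU_le _ _ _))// lerD//.
  exact: std_lognormal_mass_tail.
apply: le_trans Md; rewrite -[d in leRHS]subr0; apply: lognormal_mass_le.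
  exact: ltW.
move=> z; rewrite le_eqVlt => /predU1P[<- _|z0 _]; last first.
  exact: std_lognormal_pdf_le.
by rewrite /lognormal_pdf ltxx ltW.
Qed.

(** The strip inequality is refuted with c the density at b and e = b/100; b cancels, and a
    comparison of exp(-0.98) with exp(-1/32) remains. *)
Lemma left_truncated_std_lognormal_not_id (b : R) : 0 < b ->
  ln b = - (14%:R / 10%:R) -> ~ infinitely_divisible (left_truncation b L).
Proof.
move=> b0 lnb Pid.
have ln2 : ln 2 <= 8%:R / 10%:R :> R.
  rewrite -[leRHS]expRK ler_ln ?posrE ?expR_gt0//.
  by apply: le_trans (expR_ge_pow (n := 3) _); lra.
(* The left end 3b - e of the strip is k b when e = b/100. *)
pose k : R := 299%:R / 100%:R.
have k0 : 0 < k by rewrite /k; lra.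
have lnk_le : ln k <= 115%:R / 100%:R.
  rewrite -[leRHS]expRK ler_ln ?posrE ?expR_gt0//.
  by apply: le_trans (expR_ge_pow (n := 15) _); rewrite /k; lra.
(* An upper bound on exp(0.4) comes from exp(-0.4) >= 0.6. The value 0.4 places ln(k b) at or above
   -1, the logarithm of the mode. *)
have lnk_ge : 4%:R / 10%:R <= ln k.
  rewrite -[leLHS]expRK ler_ln ?posrE ?expR_gt0// -[leLHS]invrK -expRN.
  have := expR_ge1Dx (- (4%:R / 10%:R) : R).
  have := expR_gt0 (- (4%:R / 10%:R) : R).
  move: (expR _) => E E0 E1; rewrite -[leRHS]invrK lef_pV2 ?posrE ?invr_gt0//.
  by rewrite (le_trans _ E1)// /k; lra.
have mass0 : 0 < mass L `]0, b[%classic.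
  (* Only positivity matters here, so the exponent -4 is a crude lower bound over [b/2, b[. *)
  have : 0 < K * expR (- 4%:R) * (b - b / 2).
    by rewrite !mulr_gt0 ?expR_gt0//; lra.
  move=> /lt_le_trans; apply.
  apply: (@le_trans _ _ (mass L `[b / 2, b[%classic)); last first.
    apply: mass_le => // z /=; rewrite !in_itv/= => /andP[bz ->].
    by rewrite andbT (lt_le_trans _ bz)// divr_gt0.
  apply: lognormal_mass_ge; [by rewrite mulr_ge0 ?expR_ge0 ?ltW|by lra|].
  move=> z bz zb; have z0 : 0 < z by rewrite (lt_le_trans _ bz)// divr_gt0.
  rewrite std_lognormal_pdf_expE// ler_pM2l// ler_expR.
  have : ln z <= ln b by rewrite ler_ln ?posrE// ltW.
  have : ln (b / 2) <= ln z by rewrite ler_ln ?posrE// divr_gt0.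
  by rewrite ln_div ?posrE// lnb; move: (ln z) (ln 2) ln2 => x y; nra.
(* The exponent -x^2/2 - x is symmetric about x = -1, and ln 2 <= 0.8 keeps x = ln z within
   [-1.4, -0.6], so its minimum is at x = -1.4. *)
have pdf_ge z : b <= z -> z < b + b -> pdf b <= pdf z.
  move=> bz zb; have z0 := lt_le_trans b0 bz.
  rewrite !std_lognormal_pdf_expE// ler_pM2l// ler_expR lnb.
  have : ln b <= ln z by rewrite ler_ln.
  have : ln z <= ln (2 * b) by rewrite ler_ln ?posrE ?mulr_gt0//; lra.
  by rewrite lnM ?posrE// lnb; move: (ln z) (ln 2) ln2 => x y; nra.
(* Beyond k b the density is past its mode, hence decreasing. *)
have pdf_le z : k * b <= z -> pdf z <= pdf (k * b).
  move=> kz; have kb0 : 0 < k * b by rewrite mulr_gt0.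
  have z0 := lt_le_trans kb0 kz.
  rewrite !std_lognormal_pdf_expE// ler_pM2l// ler_expR.
  have : ln (k * b) <= ln z by rewrite ler_ln.
  by rewrite lnM ?posrE// lnb; move: (ln z) (ln k) lnk_ge => x y; nra.
pose e := b / 100%:R.
have e0 : 0 < e by rewrite divr_gt0.
have eb : e < b by rewrite /e; lra.
have kbE : 3 * b - e = k * b by rewrite /e /k; field.
have massC : mass L `[3 * b - e, 3 * b[%classic <= pdf (k * b) * e.
  rewrite [X in _ <= _ * X](_ : e = 3 * b - (3 * b - e)); last by ring.
  apply: lognormal_mass_le; first by lra.
  by move=> z; rewrite kbE => kz _; exact: pdf_le.
have c0 : 0 <= pdf b by exact: lognormal_pdf_ge0.
have Pc x y : b <= x -> x <= y -> y <= b + b ->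
    pdf b * (y - x) <= mass (left_truncation b L) `[x, y[%classic.
  move=> bx xy yb; rewrite left_truncation_mass_itv//.
  apply: lognormal_mass_ge => // z xz zy.
  by apply: pdf_ge; [exact: le_trans bx xz|exact: lt_le_trans yb].
have := infinitely_divisible_strip b0 c0 e0 eb Pid.
rewrite left_truncation_mass_gap// left_truncation_mass0 => /(_ erefl mass0 Pc).
rewrite left_truncation_mass_itv//; last by rewrite kbE /k; lra.
apply/negP; rewrite -ltNge.
apply: le_lt_trans (ler_pM (mass_ge0 _ _) (mass_ge0 _ _)
  (std_lognormal_mass_le b0 _) massC) _; first by rewrite lnb.
rewrite !std_lognormal_pdfE ?mulr_gt0// lnM ?posrE// lnb.
(* Since ln k <= 1.15, the square is at least (1/4)^2. *)
have small : expR (- ((ln k - 14%:R / 10%:R) ^+ 2 / 2)) <=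
    expR (- (1 / 32%:R)) :> R.
  by rewrite ler_expR; move: (ln k) lnk_le => x; nra.
(* Splitting 0.98 = 0.94875 + 1/32 leaves exp(-0.94875) >= 0.38, obtained from a 32nd power. *)
have : 38%:R / 100%:R * expR (- (1 / 32%:R)) <=
    expR (- ((- (14%:R / 10%:R)) ^+ 2 / 2)) :> R.
  rewrite [X in _ <= expR X](_ : _ =
    - (94875%:R / 100000%:R) + - (1 / 32%:R)); last by field.
  rewrite expRD ler_pM2r ?expR_gt0//.
  by apply: le_trans (expR_ge_pow (n := 31) _); lra.
have : 0 < expR (- (1 / 32%:R)) :> R by exact: expR_gt0.
move: small; set E := expR (- (_ ^+ 2 / 2)); set w := expR (- (_ ^+ 2 / 2)).
have w0 : 0 < w by exact: expR_gt0.
move: (expR (- (1 / 32%:R))) => v Ev v0 vw.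
(* Dividing by K^2 w leaves (1.4 / 2.51 / 299) E < (99/20000) w. It suffices that w exceeds about
   0.377 E, and w >= 0.38 v with v >= E and v > 0. *)
rewrite [X in X < _](_ : _ =
    K ^+ 2 * w * (14%:R / 10%:R / (251%:R / 100%:R) / 299%:R * E)); last first.
  by rewrite /e /k; field; rewrite gt_eqF.
have -> : (K * w / b) ^+ 2 * (e * (b - e)) / 2 =
    K ^+ 2 * w * (99%:R / 20000%:R * w).
  by rewrite /e; field; rewrite gt_eqF.
by rewrite ltr_pM2l ?mulr_gt0 ?exprn_gt0//; lra.
Qed.

End standard_lognormal.

Theorem proposition1p8 (R : realType) :
  ~ (forall (alpha : R) (sigma : {posnum R}) (b : R), 0 < b ->
       infinitely_divisible (left_truncation b (lognormal_prob alpha sigma)))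
  /\
  (forall b : R, 0 < b -> ln b = - (14%:R / 10%:R) ->
     ~ infinitely_divisible (left_truncation b (lognormal_prob 0 1%:pos))).
Proof.
split; last by move=> b; exact: left_truncated_std_lognormal_not_id.
move=> id; have b0 := expR_gt0 (- (14%:R / 10%:R) : R).
by apply: (left_truncated_std_lognormal_not_id b0); rewrite ?expRK//; exact: id.
Qed.
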